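(* Let $\mathcal A$ be a $\sigma$-bounded radical commutative ordered $^*$-algebra. Then $\mathcal A$ has a faithful representation as functions if and only if $\mathcal A$ is closed.
   Context: An ordered vector space is a real vector space $V$ with a partial order $\le$ such that $v\le w$ implies $u+v\le u+w$ and $\lambda v\le\lambda w$ for all $u\in V$, $\lambda\in[0,\infty[$; $V^+=\{v\in V:0\le v\}$. $V$ is Archimedean if, whenever $v\in V$, $w\in V^+$ satisfy $v\le\epsilon w$ for all $\epsilon\in\,]0,\infty[$, then $v\le0$. $V$ is $\sigma$-bounded if there is an increasing sequence $(\hat v_n)_{n\in\mathbb N}$ in $V^+$ such that for all $v\in V$ there is $n\in\mathbb N$ with $-\hat v_n\le v\le\hat v_n$. A $^*$-algebra is a unital associative complex algebra $\mathcal A$ (unit $1$) with an antilinear involution $^*$ satisfying $(ab)^*=b^*a^*$. $\mathcal A_{\mathrm H}=\{a\in\mathcal A:a=a^*\}$ is the real vector space of Hermitian elements. An ordered $^*$-algebra is a $^*$-algebra $\mathcal A$ with a partial order $\le$ on $\mathcal A_{\mathrm H}$ making $\mathcal A_{\mathrm H}$ an ordered vector space such that $0\le 1$ and $a^*ba\in\mathcal A_{\mathrm H}^+$ for all $a\in\mathcal A$, $b\in\mathcal A_{\mathrm H}^+$. $\mathcal A$ is called $\sigma$-bounded if $\mathcal A_{\mathrm H}$ is $\sigma$-bounded; closed if $\mathcal A_{\mathrm H}$ is Archimedean; radical if, whenever $a,b\in\mathcal A_{\mathrm H}$ commute and satisfy $1\le a$ and $0\le ab$, then $0\le b$. For a set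 $X$, $\mathbb C^X$ is the commutative ordered $^*$-algebra of all functions $X\to\mathbb C$ with pointwise operations, pointwise complex conjugation, and the pointwise order on real-valued functions. A faithful representation as functions of $\mathcal A$ is a pair $(X,\pi)$ of a set $X$ and a unital $^*$-homomorphism $\pi:\mathcal A\to\mathbb C^X$ whose restriction to Hermitian elements is an order embedding, i.e. it is injective and for all $a,b\in\mathcal A_{\mathrm H}$, $a\le b$ if and only if $\pi(a)\le\pi(b)$. *)

(* Defs.v *)
From HB Require Import structures.
From mathcomp Require Import all_boot all_order all_algebra.
From mathcomp Require Import boolp functions reals.
From mathcomp Require Export complex.

Set Implicit Arguments.
Unset Strict Implicit.
Unset Printing Implicit Defensive.

Import Order.TTheory GRing.Theory Num.Theory.
Local Open Scope ring_scope.
Local Open Scope complex_scope.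

HB.mixin Record isOrderedVect (R : realType) V
    of GRing.Lmodule R V & Num.POrderedZmodule V := {
  lev_wD2l : forall u v w : V, v <= w -> u + v <= u + w;
  lev_wpZ2l : forall (k : R) (v w : V), 0 <= k -> v <= w -> k *: v <= k *: w
}.

#[short(type="orderedVectType")]
HB.structure Definition OrderedVect (R : realType) :=
  {V of GRing.Lmodule R V & Num.POrderedZmodule V & isOrderedVect R V}.

Definition archimedean_vect (R : realType) (V : orderedVectType R) : Prop :=
  forall v w : V, 0 <= w -> (forall e : R, 0 < e -> v <= e *: w) -> v <= 0.

Definition sigma_bounded_vect (R : realType) (V : orderedVectType R) : Prop :=
  exists vhat : nat -> V,
    [/\ {homo vhat : m n / (m <= n)%N >-> m <= n},
        forall n, 0 <= vhat n
      & forall v, exists n, - vhat n <= v <= vhat n].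

(* The library's algebra structures extend [nzRingType] and so exclude the zero
   algebra (which is C^X for X empty), and [pzRingType] and [lmodType] cannot be
   joined outside of them. The scalar action is therefore a field here, and the
   [lmodType] structure is derived from it. *)
HB.mixin Record isStarAlgebra (R : realType) A of GRing.PzRing A := {
  cscale : R[i] -> A -> A;
  cscaleA : forall (k l : R[i]) (a : A),
    cscale k (cscale l a) = cscale (k * l) a;
  cscale1 : left_id 1 cscale;
  cscaleDr : right_distributive cscale +%R;
  cscaleDl : forall a : A, {morph cscale^~ a : k l / k + l};
  cscaleAl : forall (k : R[i]) (a b : A), cscale k (a * b) = cscale k a * b;
  cscaleAr : forall (k : R[i]) (a b : A), cscale k (a * b) = a * cscale k b;
  star : A -> A;
  starD : {morph star : a b / a + b};
  starZ : forall (k : R[i]) (a : A), star (cscale k a) = cscale (conjc k) (star a);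
  starM : forall a b : A, star (a * b) = star b * star a;
  starK : involutive star
}.

#[short(type="starAlgType")]
HB.structure Definition StarAlgebra (R : realType) :=
  {A of GRing.PzRing A & isStarAlgebra R A}.

#[non_forgetful_inheritance]
HB.instance Definition _ (R : realType) (A : starAlgType R) :=
  GRing.Zmodule_isLmodule.Build R[i] (StarAlgebra.sort A)
    (@cscaleA R A) (@cscale1 R A) (@cscaleDr R A) (@cscaleDl R A).

Section Hermitian.
Variables (R : realType) (A : starAlgType R).
Implicit Types (a b : A).

Definition is_herm : {pred A} := fun a => star a == a.

Record herm := Herm { herm_val :> A; _ : is_herm herm_val }.

HB.instance Definition _ := [isSub for herm_val].
HB.instance Definition _ := [Choice of herm by <:].

Lemma star0 : star (0 : A) = 0.
Proof. by apply: (addIr (star 0)); rewrite -starD !add0r. Qed.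

Lemma starN a : star (- a) = - star a.
Proof. by apply: (addIr (star a)); rewrite -starD !addNr star0. Qed.

Lemma star_scale (k : R[i]) a : star (k *: a) = conjc k *: star a.
Proof. exact: starZ. Qed.

Lemma star1 : star (1 : A) = 1.
Proof. by rewrite -[LHS]mul1r -[X in X * _]starK -starM mul1r starK. Qed.

Lemma is_herm_zmod : zmod_closed is_herm.
Proof.
split=> [|a b]; rewrite !unfold_in /is_herm; first by rewrite star0.
by move=> /eqP sa /eqP sb; rewrite starD starN sa sb.
Qed.

HB.instance Definition _ := GRing.isZmodClosed.Build A is_herm is_herm_zmod.
HB.instance Definition _ := [SubChoice_isSubZmodule of herm by <:].

Lemma hermP (x : herm) : star (x : A) = x.
Proof. by case: x => x /= /eqP. Qed.

Fact herm_scale_subproof (k : R) (x : herm) : is_herm (k%:C *: (x : A)).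
Proof. by rewrite /is_herm star_scale hermP conjc_real. Qed.
Definition herm_scale (k : R) (x : herm) := Herm (herm_scale_subproof k x).

Fact herm_scaleA (k l : R) x :
  herm_scale k (herm_scale l x) = herm_scale (k * l) x.
Proof. by apply: val_inj; rewrite /= scalerA rmorphM. Qed.
Fact herm_scale1 : left_id 1 herm_scale.
Proof. by move=> x; apply: val_inj; rewrite /= scale1r. Qed.
Fact herm_scaleDr : right_distributive herm_scale +%R.
Proof. by move=> k x y; apply: val_inj; rewrite /= scalerDr. Qed.
Fact herm_scaleDl x : {morph herm_scale^~ x : k l / k + l}.
Proof. by move=> k l; apply: val_inj; rewrite /= rmorphD scalerDl. Qed.
HB.instance Definition _ := GRing.Zmodule_isLmodule.Build R herm
  herm_scaleA herm_scale1 herm_scaleDr herm_scaleDl.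

Fact herm1_subproof : is_herm (1 : A).
Proof. by rewrite /is_herm star1. Qed.
Definition herm1 : herm := Herm herm1_subproof.

Fact herm_conj_subproof a (x : herm) : is_herm (star a * (x : A) * a).
Proof. by rewrite /is_herm !starM starK hermP mulrA. Qed.
Definition herm_conj a (x : herm) : herm := Herm (herm_conj_subproof a x).

Fact herm_mul_subproof (x y : herm) :
  GRing.comm (x : A) (y : A) -> is_herm ((x : A) * (y : A)).
Proof. by move=> cxy; rewrite /is_herm starM !hermP cxy. Qed.
Definition herm_mul (x y : herm) (cxy : GRing.comm (x : A) (y : A)) : herm :=
  Herm (herm_mul_subproof cxy).

End Hermitian.

HB.mixin Record isOrderedStarAlgebra (R : realType) A of StarAlgebra R A := {
  herm_le : rel (herm A);
  herm_le_refl : reflexive herm_le;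
  herm_le_anti : antisymmetric herm_le;
  herm_le_trans : transitive herm_le;
  herm_le_add : forall u v w : herm A,
    herm_le v w -> herm_le (u + v) (u + w);
  herm_le_scale : forall (k : R) (v w : herm A),
    0 <= k -> herm_le v w -> herm_le (k *: v) (k *: w);
  herm_le01 : herm_le 0 (herm1 A);
  herm_le_conj : forall (a : A) (b : herm A),
    herm_le 0 b -> herm_le 0 (herm_conj a b)
}.

#[short(type="orderedStarAlgType")]
HB.structure Definition OrderedStarAlgebra (R : realType) :=
  {A of StarAlgebra R A & isOrderedStarAlgebra R A}.

#[non_forgetful_inheritance]
HB.instance Definition _ (R : realType) (A : orderedStarAlgType R) :=
  GRing.Lmodule.copy (OrderedStarAlgebra.sort A)
    (StarAlgebra.sort (A : starAlgType R)).

Section HermOrder.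
Variables (R : realType) (A : orderedStarAlgType R).

HB.instance Definition _ := Order.Le_isPOrder.Build ring_display (herm A)
  (@herm_le_refl R A) (@herm_le_anti R A) (@herm_le_trans R A).
HB.instance Definition _ := isOrderedVect.Build R (herm A)
  (@herm_le_add R A) (@herm_le_scale R A).

End HermOrder.

Definition sigma_bounded (R : realType) (A : orderedStarAlgType R) : Prop :=
  sigma_bounded_vect (herm A : orderedVectType R).

Definition closed_star_alg (R : realType) (A : orderedStarAlgType R) : Prop :=
  archimedean_vect (herm A : orderedVectType R).

Definition radical_star_alg (R : realType) (A : orderedStarAlgType R) : Prop :=
  forall (a b : herm A) (cab : GRing.comm (herm_val a) (herm_val b)),
    herm1 A <= a -> 0 <= herm_mul cab -> 0 <= b.

Section FunctionAlgebra.
Variables (R : realType) (X : Type).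
Implicit Types (f g : X -> R[i]).

Definition fun_star f : X -> R[i] := fun x => conjc (f x).

Fact fun_scalerAl (k : R[i]) f g : k *: (f * g) = (k *: f) * g.
Proof. by apply/funext => x; exact: mulrA. Qed.
Fact fun_scalerAr (k : R[i]) f g : k *: (f * g) = f * (k *: g).
Proof. by apply/funext => x; exact: mulrCA. Qed.
Fact fun_starD : {morph fun_star : f g / f + g}.
Proof. by move=> f g; apply/funext => x; exact: rmorphD. Qed.
Fact fun_starZ (k : R[i]) f : fun_star (k *: f) = conjc k *: fun_star f.
Proof. by apply/funext => x; exact: rmorphM. Qed.
Fact fun_starM f g : fun_star (f * g) = fun_star g * fun_star f.
Proof. by apply/funext => x; rewrite mulrC; exact: rmorphM. Qed.
Fact fun_starK : involutive fun_star.
Proof. by move=> f; apply/funext => x; exact: conjcK. Qed.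
HB.instance Definition _ := isStarAlgebra.Build R (X -> R[i])
  (@scalerA R[i] (X -> R[i])) (@scale1r R[i] (X -> R[i]))
  (@scalerDr R[i] (X -> R[i])) (fun f k l => @scalerDl R[i] (X -> R[i]) f k l)
  fun_scalerAl fun_scalerAr fun_starD fun_starZ fun_starM fun_starK.

Local Notation hfun := (herm ((X -> R[i]) : starAlgType R)).

(* [z <= w] on [R[i]] means [Im z = Im w] and [Re z <= Re w]; on Hermitian,
   i.e. real-valued, functions this is the pointwise order of the reals. *)
Definition fun_le (f g : hfun) : bool :=
  `[< forall x, herm_val f x <= herm_val g x >].

Fact fun_le_refl : reflexive fun_le.
Proof. by move=> f; apply/asboolP. Qed.
Fact fun_le_anti : antisymmetric fun_le.
Proof.
move=> f g /andP[/asboolP fg /asboolP gf]; apply/val_inj/funext => x /=.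
by apply/le_anti; rewrite fg gf.
Qed.
Fact fun_le_trans : transitive fun_le.
Proof.
move=> g f h /asboolP fg /asboolP gh; apply/asboolP => x.
exact: le_trans (fg x) (gh x).
Qed.
Fact fun_le_add (u f g : hfun) : fun_le f g -> fun_le (u + f) (u + g).
Proof. by move=> /asboolP fg; apply/asboolP => x; rewrite /= lerD2l. Qed.
Fact fun_le_scale (k : R) (f g : hfun) :
  0 <= k -> fun_le f g -> fun_le (k *: f) (k *: g).
Proof.
move=> k0 /asboolP fg; apply/asboolP => x.
by apply: ler_wpM2l; rewrite ?ler0c ?fg.
Qed.
Fact fun_le01 : fun_le 0 (herm1 _).
Proof. by apply/asboolP => x; exact: ler01. Qed.
Fact fun_le_conj (f : X -> R[i]) (g : hfun) :
  fun_le 0 g -> fun_le 0 (herm_conj f g).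
Proof.
move=> /asboolP g0; apply/asboolP => x.
change (0 <= conjc (f x) * herm_val g x * f x).
rewrite mulrAC [X in X * _]mulrC; apply: mulr_ge0; last exact: g0.
by rewrite mul_conjC_ge0.
Qed.
HB.instance Definition _ := isOrderedStarAlgebra.Build R (X -> R[i])
  fun_le_refl fun_le_anti fun_le_trans fun_le_add fun_le_scale
  fun_le01 fun_le_conj.

End FunctionAlgebra.

Record starHom (R : realType) (A B : starAlgType R) := StarHom {
  starHom_fun :> A -> B;
  starHom_linear : linear starHom_fun;
  starHom_monoid_morphism : monoid_morphism starHom_fun;
  starHom_star : {morph starHom_fun : a / star a}
}.

Section HermMap.
Variables (R : realType) (A B : starAlgType R) (f : starHom A B).

Fact herm_map_subproof (x : herm A) : is_herm (f x).
Proof. by rewrite /is_herm -starHom_star hermP. Qed.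
Definition herm_map (x : herm A) : herm B := Herm (herm_map_subproof x).

End HermMap.

Definition faithful_representation (R : realType) (A : orderedStarAlgType R)
    (X : Type) (pi : starHom A (X -> R[i])) : Prop :=
  injective (herm_map pi) /\ {mono herm_map pi : a b / a <= b}.

Definition has_faithful_representation (R : realType)
    (A : orderedStarAlgType R) : Prop :=
  exists (X : Type) (pi : starHom A (X -> R[i])), faithful_representation pi.

(* Main.v *)
(* For closed [A] and a Hermitian [a] with [0 <= a] failing, a positive
   character [phi] with [phi a < 0] is needed. Let [v_n] be the bounding
   sequence. Starting from [g_0 = - a - e], which for some [e > 0] is not
   [<= 0], put [g_(n+1) = g_n - e_n v_n (1 + g_n^2)]; by the Archimedean
   property [e_n > 0] can be chosen so that no [g_n] is [<= 0]. This is Baire's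
   argument in algebraic form: where [g_(n+1) > 0] one has [g_n > 0] and
   [v_n < 1 / (2 e_n)].
   If [-1 = p + s g_n] with [p >= 0] and [s] a sum of squares, then
   [(1 + (1 + g_n^2) s) (- g_n) >= 0], which radicality forbids. So the quadratic
   modules generated by the positive cone and [g_n] are proper; they increase
   with [n], and Zorn's lemma gives a maximal proper one, [M], containing them
   all. Maximality allows one to cancel the factor in
   [(1 + g_n^2) (1 - 2 e_n v_n) = (1 - g_n)^2 + 2 g_(n+1) \in M],
   so every element is bounded modulo [M], and the standard part with respect to
   [M] is the required character. *)
From HB Require Import structures.
Require Import Defs.
From mathcomp Require Import all_boot all_order all_algebra.
From mathcomp Require Import reals boolp classical_sets functions.
From mathcomp Require Import ring lra.

Set Implicit Arguments.
Unset Strict Implicit.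
Unset Printing Implicit Defensive.

Import Order.TTheory GRing.Theory Num.Theory.
Local Open Scope ring_scope.
Local Open Scope complex_scope.
Local Open Scope classical_set_scope.

(** * Quadratic modules in a commutative ring and their maximal proper members *)

Section QuadraticModules.
Variable B : comPzRingType.
Implicit Types (M N P : set B) (x y g s t : B).

Definition quadratic_module M :=
  [/\ M 1, forall x y, M x -> M y -> M (x + y)
    & forall a x, M x -> M (a ^+ 2 * x)].

Definition proper_qm M := quadratic_module M /\ ~ M (-1).

Inductive sum_squares : B -> Prop :=
| sum_squares0 : sum_squares 0
| sum_squaresD a s : sum_squares s -> sum_squares (a ^+ 2 + s).

Lemma sum_squares_sqr a : sum_squares (a ^+ 2).
Proof. by rewrite -[_ ^+ 2]addr0; do 2!constructor. Qed.

Lemma sum_squares_add s t :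
  sum_squares s -> sum_squares t -> sum_squares (s + t).
Proof. by move=> + sst; elim=> [|a u _ ih]; rewrite ?add0r// -addrA; constructor. Qed.

Lemma sum_squares_mul_sqr a s : sum_squares s -> sum_squares (a ^+ 2 * s).
Proof.
elim=> [|b u _ ih]; first by rewrite mulr0; constructor.
by rewrite mulrDr -exprMn; constructor.
Qed.

Section Closure.
Variables (M : set B) (qmM : quadratic_module M).

Lemma qm1 : M 1. Proof. by case: qmM. Qed.

Lemma qmD x y : M x -> M y -> M (x + y). Proof. by case: qmM => _ + _; apply. Qed.

Lemma qm_sqrM a x : M x -> M (a ^+ 2 * x). Proof. by case: qmM => _ _; apply. Qed.

Lemma qm_sqr a : M (a ^+ 2).
Proof. by rewrite -[_ ^+ 2]mulr1; apply/qm_sqrM/qm1. Qed.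

Lemma qm0 : M 0.
Proof. by rewrite -[0](expr0n B 2); exact: qm_sqr. Qed.

Lemma qm_sosM s x : sum_squares s -> M x -> M (s * x).
Proof.
move=> ss Mx; elim: ss => [|a u _ ih]; first by rewrite mul0r; exact: qm0.
by rewrite mulrDl; apply: qmD => //; exact: qm_sqrM.
Qed.

Lemma qm_sos s : sum_squares s -> M s.
Proof. by move=> ss; rewrite -[s]mulr1; exact: qm_sosM ss qm1. Qed.

End Closure.

(** The quadratic module generated by [M] and [g]; no products of [g] with elements of [M] occur, as
    [M] need not be closed under multiplication. *)
Definition qm_adjoin M g : set B :=
  [set x | exists p s, [/\ M p, sum_squares s & x = p + s * g]].

Lemma sub_qm_adjoin M g : M `<=` qm_adjoin M g.
Proof.
by move=> x Mx; exists x, 0; split=> //; [constructor|rewrite mul0r addr0].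
Qed.

Lemma mem_qm_adjoin M g : quadratic_module M -> qm_adjoin M g g.
Proof.
move=> qmM; exists 0, (1 ^+ 2).
by split; [exact: qm0|exact: sum_squares_sqr|rewrite expr1n mul1r add0r].
Qed.

Lemma qm_adjoin_qm M g : quadratic_module M -> quadratic_module (qm_adjoin M g).
Proof.
move=> qmM; split; first by apply: sub_qm_adjoin; exact: qm1.
- move=> _ _ [p [s [Mp ss ->]]] [q [t [Mq st ->]]]; exists (p + q), (s + t).
  by split; [exact: qmD|exact: sum_squares_add|ring].
- move=> a _ [p [s [Mp ss ->]]]; exists (a ^+ 2 * p), (a ^+ 2 * s).
  by split; [exact: qm_sqrM|exact: sum_squares_mul_sqr|ring].
Qed.

Lemma qm_adjoin_min M N g :
  quadratic_module N -> M `<=` N -> N g -> qm_adjoin M g `<=` N.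
Proof.
move=> qmN MN Ng _ [p [s [Mp ss ->]]].
by apply: qmD => //; [exact: MN|exact: qm_sosM].
Qed.

Lemma bigcup_proper_qm (F : set (set B)) : F !=set0 -> total_on F subset ->
  (forall M, F M -> proper_qm M) -> proper_qm (\bigcup_(M in F) M).
Proof.
move=> [M0 FM0] Ftot Fqm; split; last first.
  by move=> [M FM Mm1]; case: (Fqm M FM).
split.
- by exists M0 => //; apply: qm1; case: (Fqm M0 FM0).
- move=> x y [M FM Mx] [N FN Ny].
  case: (Ftot M N FM FN) => MN.
    by exists N => //; apply: qmD => //; [case: (Fqm N FN)|exact: MN].
  by exists M => //; apply: qmD => //; [case: (Fqm M FM)|exact: MN].
- by move=> a x [M FM Mx]; exists M => //; apply: qm_sqrM => //; case: (Fqm M FM).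
Qed.

Definition maximal_qm M :=
  proper_qm M /\ forall N, proper_qm N -> M `<=` N -> N `<=` M.

Lemma exists_maximal_qm M : proper_qm M -> exists2 N, maximal_qm N & M `<=` N.
Proof.
move=> pM; pose T := [set X | X = set0 \/ (proper_qm X /\ M `<=` X)].
have [|N [TN Nmax]] := @Zorn_bigcup _ T.
  move=> F FT Ftot; have [FX|F0] := pselect (exists2 X, F X & X !=set0); last first.
    left; rewrite -subset0 => x [X FX Xx]; apply: F0; exists X => //.
    by exists x.
  case: FX => X0 FX0 [x0 X0x0].
  (* Discarding empty members leaves the union unchanged and makes every remaining member a proper
     quadratic module. *)
  have -> : \bigcup_(X in F) X = \bigcup_(X in F `&` [set X | X !=set0]) X.
    rewrite eqEsubset; split=> x [X].
      by move=> FX Xx; exists X => //; split=> //; exists x.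
    by move=> [FX _] Xx; exists X.
  have FT' X : F X -> X !=set0 -> proper_qm X /\ M `<=` X.
    by move=> FX [x Xx]; case: (FT X FX) => // Xe; rewrite Xe in Xx.
  right; split.
    apply: bigcup_proper_qm; first by exists X0; split=> //; exists x0.
      by move=> X Y [FX _] [FY _]; exact: Ftot.
    by move=> X [FX X1]; case: (FT' X FX X1).
  move=> x Mx; exists X0; first by split=> //; exists x0.
  by have [|_] := FT' X0 FX0; [exists x0|apply].
have M1 : M 1 by apply: qm1; case: pM.
case: TN => [N0|[pN MN]].
  exfalso; apply: (Nmax M); last by right; split.
  rewrite properEneq N0; split; last exact: sub0set.
  by apply/eqP => M0; rewrite -M0 in M1.
exists N => //; split=> // X pX NX; apply: contrapT => XN; apply: (Nmax X).
  by split.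
by right; split=> //; exact: subset_trans NX.
Qed.

Section Maximal.
Variables (M : set B) (maxM : maximal_qm M).

Lemma maximal_qm_qm : quadratic_module M. Proof. by case: maxM => -[]. Qed.

Lemma maximal_qmN1 : ~ M (-1). Proof. by case: maxM => -[]. Qed.
Local Notation qmM := maximal_qm_qm.

(** By maximality, adjoining [x] to [M] must produce -1. *)
Lemma maximal_qm_notin x :
  ~ M x -> exists p s, [/\ M p, sum_squares s & p + s * x = -1].
Proof.
move=> Mx; apply: contrapT => np; apply: Mx.
case: maxM => _ /(_ (qm_adjoin M x)); apply.
- split; first by apply: qm_adjoin_qm; exact: qmM.
  by move=> [p [s [Mp ss e]]]; apply: np; exists p, s.
- exact: sub_qm_adjoin.
- by apply: mem_qm_adjoin; exact: qmM.
Qed.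

(** If both fail, then -1 = p + s x = q - t x. Weighting the two by t and s cancels x, so -(s + t) =
    t p + s q lies in [M], hence so does -s. With both s and -s in [M], the term s x can be written
    inside [M]. *)
Lemma maximal_qm_total x : M x \/ M (- x).
Proof.
apply: contrapT => /not_orP[/maximal_qm_notin[p [s [Mp ss e]]]].
move=> /maximal_qm_notin[q [t [Mq st f]]]; apply: maximal_qmN1.
have MNst : M (- (s + t)).
  have -> : - (s + t) = t * p + s * q.
    have -> : - (s + t) = t * -1 + s * -1 by ring.
    by rewrite -{1}e -f; ring.
  by apply: (qmD qmM); apply: (qm_sosM qmM).
have MNs : M (- s).
  have -> : - s = - (s + t) + t by ring.
  by apply: (qmD qmM) => //; exact: (qm_sos qmM).
have M3 : M (1 + 1 + 1) by do !apply: (qmD qmM); exact: qm1 qmM.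
(* Four times p + s x = -1, with 4 s x = (x + 1)^2 s - (x - 1)^2 s; adding 3 turns -4 into -1
   without dividing by 2. *)
have -> : -1 = (1 + 1 + 1) + ((1 + 1) ^+ 2 * p + (x + 1) ^+ 2 * s +
    (x - 1) ^+ 2 * (- s)) :> B.
  have -> : p = -1 - s * x by rewrite -e; ring.
  by ring.
do !apply: (qmD qmM) => //; apply: (qm_sqrM qmM) => //.
exact: (qm_sos qmM).
Qed.

(** Otherwise -1 = p + t x, and multiplying by 1 + s leaves x only in the product (1 + s) x, which
    is in [M]; moving s across exhibits -1 in [M]. *)
Lemma maximal_qm_cancel s x : sum_squares s -> M ((1 + s) * x) -> M x.
Proof.
move=> ss Msx; apply: contrapT => /maximal_qm_notin[p [t [Mp st e]]].
apply: maximal_qmN1.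
have -> : -1 = s + (p + s * p + t * ((1 + s) * x)).
  have -> : p = -1 - t * x by rewrite -e; ring.
  by ring.
by do !apply: (qmD qmM) => //; [exact: (qm_sos qmM)|
  exact: (qm_sosM qmM)|exact: (qm_sosM qmM)].
Qed.

End Maximal.

End QuadraticModules.

(** * The standard part with respect to a maximal quadratic module is a character *)

Section StandardPart.
Variables (R : realType) (B : comPzRingType) (c : {rmorphism R -> B}).

(** An upper bound for every [x] suffices: the one for [- x] is a lower bound for [x]. *)
Definition archimedean_qm (M : set B) := forall x, exists r, M (c r - x).

Lemma qm_const (M : set B) r : quadratic_module M -> 0 <= r -> M (c r).
Proof.
by move=> qmM r0; rewrite -(sqr_sqrtr r0) rmorphXn; exact: qm_sqr.
Qed.

Lemma qm_constM (M : set B) r x :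
  quadratic_module M -> 0 <= r -> M x -> M (c r * x).
Proof.
by move=> qmM r0 Mx; rewrite -(sqr_sqrtr r0) rmorphXn; exact: qm_sqrM.
Qed.

Lemma proper_qm_const (M : set B) r : proper_qm M -> M (c r) -> 0 <= r.
Proof.
move=> [qmM M1] Mr; rewrite leNgt; apply/negP => r0; apply: M1.
have -> : -1 = c (- r^-1) * c r.
  by rewrite -rmorphM mulNr mulVf ?lt_eqF// rmorphN1.
by apply: qm_constM => //; rewrite oppr_ge0 invr_le0 ltW.
Qed.

Variables (M : set B) (maxM : maximal_qm M) (archM : archimedean_qm M).
Let qmM := maximal_qm_qm maxM.
Let pM : proper_qm M. Proof. by case: maxM. Qed.
Implicit Types (x y : B) (r s e : R).

(** Says that [x - c r] is infinitesimal for the preorder in which [M] is the set of nonnegative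
    elements. *)
Definition std_part x r :=
  forall e, 0 < e -> M (c (r + e) - x) /\ M (x - c (r - e)).

Lemma std_part_uniq x r s : std_part x r -> std_part x s -> r = s.
Proof.
suff le r' s' : std_part x r' -> std_part x s' -> r' <= s'.
  by move=> xr xs; apply/le_anti; rewrite !le.
move=> xr xs; apply/ler_addgt0Pr => e e0.
have e20 : 0 < e / 2 by rewrite divr_gt0.
rewrite -subr_ge0; apply: (proper_qm_const pM).
have -> : c (s' + e - r') = (c (s' + e / 2) - x) + (x - c (r' - e / 2)).
  by rewrite addrA subrK -rmorphB; congr (c _); field.
by apply: (qmD qmM); [case: (xs _ e20)|case: (xr _ e20)].
Qed.

(** The standard part is the supremum of all s with x - s in [M]. The bounds for x and -x make it
    finite; above the supremum membership fails, so totality of [M] provides the opposite sign. *)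
Lemma std_part_exists x : exists r, std_part x r.
Proof.
pose S := [set s | M (x - c s)].
have S0 : S !=set0.
  have [r Mr] := archM (- x); exists (- r).
  by rewrite /S/= rmorphN opprK addrC -[X in _ + X]opprK.
have [b Mb] := archM x.
have Sb : ubound S b.
  move=> s Ss; rewrite -subr_ge0; apply: (proper_qm_const pM).
  have -> : c (b - s) = (c b - x) + (x - c s) by rewrite rmorphB addrA subrK.
  exact: (qmD qmM).
have supS : has_sup S by split=> //; exists b.
exists (sup S) => e e0; split.
  have [//|Mx] := maximal_qm_total maxM (c (sup S + e) - x).
  exfalso; have : S (sup S + e) by rewrite /S/= -opprB.
  by move/(sup_upper_bound supS); rewrite gerDl leNgt e0.
have [s Ss lts] := sup_adherent e0 supS.
have -> : x - c (sup S - e) = (x - c s) + c (s - (sup S - e)).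
  by ring.
by apply: (qmD qmM) => //; apply: qm_const => //; rewrite subr_ge0 ltW.
Qed.

Lemma std_partD x y r s :
  std_part x r -> std_part y s -> std_part (x + y) (r + s).
Proof.
move=> xr ys e e0; have e20 : 0 < e / 2 by rewrite divr_gt0.
have [xr1 xr2] := xr _ e20; have [ys1 ys2] := ys _ e20; split.
  have -> : r + s + e = (r + e / 2) + (s + e / 2) by field.
  by rewrite rmorphD opprD addrACA; exact: (qmD qmM).
have -> : r + s - e = (r - e / 2) + (s - e / 2) by field.
by rewrite rmorphD opprD addrACA; exact: (qmD qmM).
Qed.

Lemma std_partN x r : std_part x r -> std_part (- x) (- r).
Proof.
move=> xr e e0; have [xr1 xr2] := xr e e0; split.
  have -> : c (- r + e) - - x = x - c (r - e) by rewrite !rmorphD !rmorphN; ring.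
  exact: xr2.
have -> : - x - c (- r - e) = c (r + e) - x by rewrite !rmorphD !rmorphN; ring.
exact: xr1.
Qed.

Lemma std_part_const r : std_part (c r) r.
Proof.
move=> e e0; rewrite -!rmorphB; split; apply: qm_const => //; lra.
Qed.

Lemma std_partZ k x r : std_part x r -> std_part (c k * x) (k * r).
Proof.
wlog k0 : k / 0 <= k.
  move=> wl; have [|k0 xr] := leP 0 k; first exact: wl.
  have := wl (- k); rewrite oppr_ge0 ltW// => /(_ isT xr)/std_partN.
  by rewrite rmorphN !mulNr !opprK.
move: k0; rewrite le_eqVlt => /predU1P[<- _|k0 xr e e0].
  by rewrite rmorph0 !mul0r -(rmorph0 c); exact: std_part_const.
have [xr1 xr2] := xr (e / k) (divr_gt0 e0 k0).
have kK : k * (e / k) = e by rewrite mulrC divfK// gt_eqF.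
split.
  rewrite -[e in k * r + e]kK -mulrDr rmorphM -mulrBr.
  by apply: qm_constM => //; exact: ltW.
rewrite -[e in k * r - e]kK -mulrBr rmorphM -mulrBr.
by apply: qm_constM => //; exact: ltW.
Qed.

(* [2 d (d^2 - x^2) = (d - x)(d + x)^2 + (d + x)(d - x)^2]: this makes up for
   [M] not being assumed closed under products. *)
Lemma std_part_sqr0 x : std_part x 0 -> std_part (x ^+ 2) 0.
Proof.
move=> x0 e e0; split; last first.
  rewrite sub0r rmorphN opprK; apply: (qmD qmM); first exact: qm_sqr.
  by apply: qm_const => //; exact: ltW.
pose d := Num.sqrt e; have d0 : 0 < d by rewrite sqrtr_gt0.
have [x1 x2] := x0 d d0; rewrite add0r sub0r rmorphN opprK in x1 x2.
have -> : c (0 + e) - x ^+ 2 = c ((2 * d)^-1) *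
   ((c d + x) ^+ 2 * (c d - x) + (c d - x) ^+ 2 * (x + c d)).
  have -> : (c d + x) ^+ 2 * (c d - x) + (c d - x) ^+ 2 * (x + c d) =
     c (2 * d) * (c (d ^+ 2) - x ^+ 2) by ring.
  rewrite mulrA -rmorphM mulVf; last by rewrite mulf_neq0// gt_eqF.
  by rewrite rmorph1 mul1r sqr_sqrtr ?ltW// add0r.
apply: qm_constM => //; first by rewrite invr_ge0 mulr_ge0// ltW.
by apply: (qmD qmM); exact: qm_sqrM.
Qed.

(** Translation by [r] reduces to the infinitesimal case: x^2 = (x - r)^2 + (2 r x - r^2). *)
Lemma std_part_sqr x r : std_part x r -> std_part (x ^+ 2) (r ^+ 2).
Proof.
move=> xr; have /std_part_sqr0 xr0 : std_part (x - c r) 0.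
  by rewrite -(subrr r); exact: std_partD xr (std_partN (std_part_const r)).
have -> : x ^+ 2 = (x - c r) ^+ 2 + (c (2 * r) * x - c (r ^+ 2)) by ring.
have {2}-> : r ^+ 2 = 0 + (2 * r * r - r ^+ 2) by ring.
apply: std_partD xr0 (std_partD (std_partZ _ xr) (std_partN _)).
exact: std_part_const.
Qed.

(** Polarisation, 4 x y = (x + y)^2 - (x - y)^2, reduces products to squares. *)
Lemma std_partM x y r s :
  std_part x r -> std_part y s -> std_part (x * y) (r * s).
Proof.
move=> xr ys.
have -> : x * y = c (4^-1) * ((x + y) ^+ 2 - (x - y) ^+ 2).
  have -> : (x + y) ^+ 2 - (x - y) ^+ 2 = c 4 * (x * y) by ring.
  by rewrite mulrA -rmorphM mulVf ?rmorph1 ?mul1r// pnatr_eq0.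
have -> : r * s = 4^-1 * ((r + s) ^+ 2 - (r - s) ^+ 2) by field.
apply/std_partZ/std_partD; first exact/std_part_sqr/std_partD.
exact/std_partN/std_part_sqr/std_partD/std_partN.
Qed.

Lemma std_part_ge0 x r : M x -> std_part x r -> 0 <= r.
Proof.
move=> Mx xr; apply/ler_addgt0Pr => e e0.
apply: (proper_qm_const pM); have [Mr _] := xr e e0.
by rewrite -[c _](subrK x); exact: (qmD qmM).
Qed.

End StandardPart.

Record positive_character (R : realType) (B : comPzRingType)
    (c : {rmorphism R -> B}) (P : set B) (phi : B -> R) : Prop := {
  characterD : {morph phi : x y / x + y};
  characterM : {morph phi : x y / x * y};
  characterC : forall r, phi (c r) = r;
  character_ge0 : forall x, P x -> 0 <= phi x
}.

Lemma maximal_qm_character (R : realType) (B : comPzRingType)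
    (c : {rmorphism R -> B}) (M : set B) :
  maximal_qm M -> archimedean_qm c M -> exists phi, positive_character c M phi.
Proof.
move=> maxM archM.
have [phi phiP] := choice (std_part_exists maxM archM).
exists phi; split=> [x y|x y|r|x Mx].
- exact: (std_part_uniq maxM (phiP _) (std_partD maxM (phiP _) (phiP _))).
- exact: (std_part_uniq maxM (phiP _) (std_partM maxM (phiP _) (phiP _))).
- exact: (std_part_uniq maxM (phiP _) (std_part_const c maxM r)).
- exact: (std_part_ge0 maxM Mx (phiP x)).
Qed.

(** * Separation by positive characters, for an abstract positive cone [P] that is radical and
    Archimedean *)

Section Separation.
Variables (R : realType) (B : comPzRingType) (c : {rmorphism R -> B}).
Variable P : set B.
Hypothesis qmP : quadratic_module P.
Hypothesis radP : forall a b : B, P (a - 1) -> P (a * b) -> P b.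
Hypothesis archP : forall v w,
  P w -> (forall e : R, 0 < e -> P (c e * w - v)) -> P (- v).

Lemma radical_adjoin_proper g : ~ P (- g) -> proper_qm (qm_adjoin P g).
Proof.
move=> Pg; split; first exact: qm_adjoin_qm.
move=> [p [s [Pp ss e]]]; apply: Pg.
have Ps := qm_sos qmP ss.
(* The factor 1 + g^2 on s creates the g^2 that absorbs the linear term in 1 - g + g^2; doubling
   makes this (1 - g)^2 + 1 + g^2, a sum of squares without halves. *)
apply: (radP (a := (1 + 1) * (1 + (1 + g ^+ 2) * s))).
  have -> : (1 + 1) * (1 + (1 + g ^+ 2) * s) - 1 =
    1 + (s + s) + (g ^+ 2 * s + g ^+ 2 * s) by ring.
  by do !apply: (qmD qmP) => //; [exact: qm1|exact: (qm_sqrM qmP)..].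
have -> : (1 + 1) * (1 + (1 + g ^+ 2) * s) * (- g) =
    1 + (1 - g) ^+ 2 + g ^+ 2 + (1 + 1) * p + (1 + 1) * (g ^+ 2 * p).
  have -> : p = -1 - s * g by rewrite e; ring.
  by ring.
rewrite !mulrDl !mul1r.
do !apply: (qmD qmP) => //; do ?[exact: qm1|exact: (qm_sqr qmP)|exact: (qm_sqrM qmP)].
Qed.

(** If every e failed, g would lie below all positive multiples of v (1 + g^2), and the Archimedean
    property would give -g in [P]. *)
Lemma archimedean_shrink g v : ~ P (- g) -> P v ->
  exists2 e, 0 < e & ~ P (- (g - c e * (v * (1 + g ^+ 2)))).
Proof.
move=> Pg Pv; apply: contrapT => ne; apply: Pg.
apply: (archP (w := v * (1 + g ^+ 2))).
  have -> : v * (1 + g ^+ 2) = v + g ^+ 2 * v by ring.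
  by apply: (qmD qmP) => //; exact: (qm_sqrM qmP).
move=> e e0; apply: contrapT => Pe; apply: ne; exists e => //.
by rewrite opprB.
Qed.

Lemma radical_separation (v : nat -> B) a :
    (forall n, P (v n)) -> (forall x, exists n, P (v n - x)) -> ~ P a ->
  exists2 phi, positive_character c P phi & phi a < 0.
Proof.
move=> Pv vb Pa.
(* The Archimedean property with bound 1. The margin [e0] is what later makes the inequality for
   [phi a] strict. *)
have [e0 e00 Pg0] : exists2 e, 0 < e & ~ P (- (- a - c e)).
  apply: contrapT => ne; apply: Pa; rewrite -[a]opprK.
  apply: (archP (qm1 qmP)) => e e0; apply: contrapT => Pe; apply: ne.
  by exists e => //; rewrite mulr1 in Pe; rewrite opprB.
pose T := {g | ~ P (- g)}.
(* The constants are chosen for all admissible g and all n at once, since the sequence itself is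
   only defined afterwards; carrying admissibility in the type [T] lets the recursion proceed. *)
have /choice[eps epsP] (gn : T * nat) : exists e,
    0 < e /\ ~ P (- (sval gn.1 - c e * (v gn.2 * (1 + sval gn.1 ^+ 2)))).
  case: gn => -[g Pg] n /=.
  by have [e ? ?] := archimedean_shrink Pg (Pv n); exists e.
pose step n (g : T) : T := exist (fun g => ~ P (- g)) _ (epsP (g, n)).2.
pose G := nat_rect (fun=> T) (exist (fun g => ~ P (- g)) _ Pg0) step.
pose g n := sval (G n).
pose e n := eps (G n, n).
have gS n : g n = g n.+1 + c (e n) * (v n * (1 + g n ^+ 2)).
  by rewrite [X in X + _]/g /= subrK.
have en0 n : 0 < e n by case: (epsP (G n, n)).
pose Q n := qm_adjoin P (g n).
have pQ n : proper_qm (Q n) by exact: radical_adjoin_proper (svalP (G n)).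
have Qg n : Q n (g n) by exact: mem_qm_adjoin.
(* By [gS], g_n is g_(n+1) plus an element of [P]. *)
have QS n : Q n `<=` Q n.+1.
  have [qmQ _] := pQ n.+1.
  apply: qm_adjoin_min => //; first exact: sub_qm_adjoin.
  rewrite gS; apply: (qmD qmQ) => //; apply: qm_constM => //; first exact: ltW.
  apply: sub_qm_adjoin.
  have -> : v n * (1 + g n ^+ 2) = v n + g n ^+ 2 * v n by ring.
  by apply: (qmD qmP) => //; exact: (qm_sqrM qmP).
have Qle m n : (m <= n)%N -> Q m `<=` Q n.
  elim: n => [|n ih]; first by rewrite leqn0 => /eqP ->.
  rewrite leq_eqVlt => /predU1P[->//|]; rewrite ltnS => /ih mn.
  exact: subset_trans mn (QS n).
have pU : proper_qm (\bigcup_(N in range Q) N).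
  apply: bigcup_proper_qm; first by exists (Q 0%N); exists 0%N.
  - move=> _ _ [m _ <-] [n _ <-].
    by case: (leqP m n) => [|/ltnW] /Qle; [left|right].
  - by move=> _ [n _ <-].
have [M maxM UM] := exists_maximal_qm pU.
have qmM := maximal_qm_qm maxM.
have QM n : Q n `<=` M.
  by move=> x Qx; apply: UM; exists (Q n) => //; exists n.
have PM : P `<=` M by move=> x Px; apply: (QM 0%N); exact: sub_qm_adjoin.
have archM : archimedean_qm c M.
  move=> x; have [n vx] := vb x; exists (2 * e n)^-1.
  have en2 : 0 < 2 * e n by rewrite mulr_gt0.
  have Mv : M (1 - c (2 * e n) * v n).
    apply: (maximal_qm_cancel maxM (sum_squares_sqr (g n))).
    have -> : (1 + g n ^+ 2) * (1 - c (2 * e n) * v n) =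
        (1 - g n) ^+ 2 + c 2 * g n.+1.
      have -> : g n.+1 = g n - c (e n) * (v n * (1 + g n ^+ 2)).
        by apply: (canRL (addrK _)); rewrite -gS.
      by ring.
    apply: (qmD qmM); first exact: (qm_sqr qmM).
    by apply: qm_constM => //; apply: QM (Qg _).
  (* Modulo [M], x is at most v_n, which [Mv] bounds by 1 / (2 e_n). *)
  have -> : c (2 * e n)^-1 - x =
      c (2 * e n)^-1 * (1 - c (2 * e n) * v n) + (v n - x).
    rewrite mulrBr mulr1 mulrA -rmorphM mulVf ?gt_eqF// rmorph1 mul1r.
    by rewrite addrA subrK.
  apply: (qmD qmM); last exact: PM.
  by apply: qm_constM => //; rewrite invr_ge0 ltW.
have [phi phiP] := maximal_qm_character maxM archM.
exists phi; first by case: phiP => ? ? ? phi0; split=> // x /PM; exact: phi0.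
(* As g_0 = -a - e0, this says that phi (-a) is at least e0 > 0. *)
have phi0 : 0 <= phi (g 0%N) by apply: (character_ge0 phiP); exact: QM (Qg 0%N).
have : 0 + e0 <= phi (g 0%N) + e0 by rewrite lerD2r.
rewrite -[in leRHS](characterC phiP e0) -(characterD phiP) /g /= subrK add0r.
move=> e0a; rewrite -oppr_gt0; apply: lt_le_trans e00 (le_trans e0a _).
have /(congr1 (fun t => t - phi a)) := characterD phiP (- a) a.
rewrite addrK addNr -(rmorph0 c) (characterC phiP) sub0r => ->.
exact: lexx.
Qed.

End Separation.

(** * The Hermitian elements of a commutative algebra as a commutative ring with a positive cone *)

Section HermitianRing.
Variables (R : realType) (A : orderedStarAlgType R).
Hypothesis mulC : commutative (@GRing.mul A).

(* The argument carries the proof of commutativity on which the ring structure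
   of Hermitian elements depends. *)
Definition comm_herm of commutative (@GRing.mul A) : Type := herm A.
Local Notation H := (comm_herm mulC).

HB.instance Definition _ := GRing.Zmodule.copy H (herm A).

Definition comm_herm_mul (x y : H) : H :=
  herm_mul (mulC (herm_val x) (herm_val y)).
Definition comm_herm1 : H := herm1 A.

Fact comm_herm_mulA : associative comm_herm_mul.
Proof. by move=> x y z; apply: val_inj; exact: mulrA. Qed.
Fact comm_herm_mulC : commutative comm_herm_mul.
Proof. by move=> x y; apply: val_inj; exact: mulC. Qed.
Fact comm_herm_mul1 : left_id comm_herm1 comm_herm_mul.
Proof. by move=> x; apply: val_inj; exact: mul1r. Qed.
Fact comm_herm_mulD : left_distributive comm_herm_mul +%R.
Proof. by move=> x y z; apply: val_inj; exact: mulrDl. Qed.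

HB.instance Definition _ := GRing.Zmodule_isComPzRing.Build H
  comm_herm_mulA comm_herm_mulC comm_herm_mul1 comm_herm_mulD.

Definition herm_const (r : R) : H := herm_scale r (herm1 A).

Lemma herm_constM r (x : H) : herm_const r * x = r *: (x : herm A).
Proof.
apply: val_inj; change ((r%:C *: (1 : A)) * herm_val x = r%:C *: herm_val x).
by rewrite -[RHS]/(cscale _ _) -{2}[herm_val x]mul1r cscaleAl.
Qed.

Fact herm_const_zmod_morphism : zmod_morphism herm_const.
Proof.
move=> r s; apply: val_inj.
change ((r - s)%:C *: (1 : A) = r%:C *: (1 : A) - s%:C *: (1 : A)).
by rewrite rmorphB scalerBl.
Qed.
Fact herm_const_monoid_morphism : monoid_morphism herm_const.
Proof.
split=> [|r s]; first by apply: val_inj; exact: scale1r.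
by rewrite herm_constM; apply: val_inj; rewrite /= scalerA rmorphM.
Qed.

HB.instance Definition _ := GRing.isZmodMorphism.Build R H herm_const
  herm_const_zmod_morphism.
HB.instance Definition _ := GRing.isMonoidMorphism.Build R H herm_const
  herm_const_monoid_morphism.

Definition herm_nneg : set H := [set x | 0 <= (x : herm A)].

Lemma herm_addr_ge0 (x y : herm A) : 0 <= x -> 0 <= y -> 0 <= x + y.
Proof.
move=> x0 y0; apply: le_trans x0 _; rewrite -{1}[x]addr0.
exact: lev_wD2l.
Qed.

Lemma herm_subr_ge0 (x y : herm A) : (0 <= y - x) = (x <= y).
Proof.
apply/idP/idP => h.
  by have := lev_wD2l x _ _ h; rewrite addr0 addrC subrK.
by have := lev_wD2l (- x) _ _ h; rewrite addNr addrC.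
Qed.

Lemma herm_nneg_qm : quadratic_module herm_nneg.
Proof.
split; first exact: herm_le01.
  by move=> x y; exact: herm_addr_ge0.
move=> a x x0; rewrite /herm_nneg/=.
(* For Hermitian a, commutativity turns a^2 x into the conjugation a* x a, which preserves
   positivity by the axioms. *)
have -> : a ^+ 2 * x = herm_conj (herm_val a) x :> herm A.
  apply: val_inj; change (herm_val a * herm_val a * herm_val x =
    star (herm_val a) * herm_val x * herm_val a).
  by rewrite hermP -mulrA [RHS]mulC mulrA.
exact: herm_le_conj.
Qed.

Lemma closed_separation (a : herm A) :
    sigma_bounded A -> radical_star_alg A -> closed_star_alg A -> ~~ (0 <= a) ->
  exists2 phi : H -> R, positive_character herm_const herm_nneg phi & phi a < 0.
Proof.
move=> [v [_ v0 vb]] radA clA /negP a0.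
apply: (@radical_separation _ _ _ _ herm_nneg_qm _ _ v) => //.
- move=> x y; rewrite /herm_nneg/= => x1 xy0.
  apply: (radA x y (mulC _ _)); last exact: xy0.
  by rewrite -herm_subr_ge0.
- move=> x w w0 h; rewrite /herm_nneg/= -[- x]add0r herm_subr_ge0.
  apply: (clA _ w) => // e /h; rewrite /herm_nneg/= herm_constM.
  by rewrite herm_subr_ge0.
- move=> x; have [n /andP[_ xn]] := vb x; exists n.
  by rewrite /herm_nneg/= herm_subr_ge0.
Qed.

End HermitianRing.

(** * Decomposition of elements into real and imaginary Hermitian parts *)

Section CartesianDecomposition.
Variables (R : realType) (A : orderedStarAlgType R).
Implicit Types (a b : A) (x y : herm A) (k : R[i]).

Lemma star_scale_mull k a b : (k *: a) * b = k *: (a * b).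
Proof. exact/esym/cscaleAl. Qed.

Lemma star_scale_mulr k a b : a * (k *: b) = k *: (a * b).
Proof. exact/esym/cscaleAr. Qed.

Fact herm_re_subproof a : is_herm ((2^-1)%:C *: (a + star a)).
Proof.
by apply/eqP; rewrite star_scale conjc_real starD starK addrC.
Qed.
Definition herm_re a : herm A := Herm (herm_re_subproof a).

(** The scalar is 1 / (2 i). *)
Fact herm_im_subproof a : is_herm ((0 -i* 2^-1) *: (a - star a)).
Proof.
apply/eqP; rewrite star_scale starD starN starK -opprB scalerN -scaleNr.
by congr (_ *: _); apply/eqP; rewrite eq_complex/= oppr0 !opprK !eqxx.
Qed.
Definition herm_im a : herm A := Herm (herm_im_subproof a).

Definition cart x y : A := herm_val x + 'i *: herm_val y.

Lemma star_cart x y : star (cart x y) = cart x (- y).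
Proof.
rewrite starD star_scale !hermP; congr (_ + _).
rewrite [RHS]scalerN -scaleNr; congr (_ *: _).
by apply/eqP; rewrite eq_complex/= oppr0 !eqxx.
Qed.

Lemma half_scale a : (2^-1)%:C *: (a + a) = a.
Proof.
rewrite -mulr2n -scaler_nat scalerA -(rmorph_nat (real_complex R) 2) -rmorphM.
by rewrite mulVf ?pnatr_eq0// rmorph1 scale1r.
Qed.

Lemma herm_re_cart x y : herm_re (cart x y) = x.
Proof.
apply: val_inj => /=; rewrite star_cart /cart /= scalerN addrACA subrr addr0.
exact: half_scale.
Qed.

Lemma herm_im_cart x y : herm_im (cart x y) = y.
Proof.
apply: val_inj => /=; rewrite star_cart /cart /= scalerN opprD opprK addrACA.
rewrite subrr add0r -scalerDr scalerA -[RHS]half_scale; congr (_ *: _).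
by simpc.
Qed.

Lemma cart_re_im a : a = cart (herm_re a) (herm_im a).
Proof.
rewrite /cart /= scalerA.
have -> : 'i * (0 -i* 2^-1) = (2^-1)%:C :> R[i] by simpc.
by rewrite -scalerDr addrACA subrr addr0 half_scale.
Qed.

Lemma cartD x y x' y' : cart x y + cart x' y' = cart (x + x') (y + y').
Proof. by rewrite /cart /= scalerDr addrACA. Qed.

Lemma cartZ k x y : k *: cart x y =
  cart (complex.Re k *: x - complex.Im k *: y)
       (complex.Re k *: y + complex.Im k *: x).
Proof.
rewrite /cart /= !scalerDr !scalerA {1 2}[k]complexE.
rewrite mulrDl !scalerDl.
have -> : 'i * (complex.Im k)%:C * 'i = - (complex.Im k)%:C :> R[i].
  by rewrite mulrAC -expr2 sqr_i mulN1r.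
rewrite scaleNr [_ *: herm_val y - _]addrC addrACA [_%:C * 'i]mulrC.
by congr (_ + _); rewrite addrC.
Qed.

Lemma cartM (mulC : commutative (@GRing.mul A)) x y x' y' :
  cart x y * cart x' y' =
  cart (herm_mul (mulC (herm_val x) (herm_val x'))
          - herm_mul (mulC (herm_val y) (herm_val y')))
       (herm_mul (mulC (herm_val x) (herm_val y'))
          + herm_mul (mulC (herm_val y) (herm_val x'))).
Proof.
rewrite /cart /= mulrDl !mulrDr !star_scale_mull !star_scale_mulr.
rewrite scalerA scalerDr.
have -> : 'i * 'i = -1 :> R[i] by rewrite -expr2 sqr_i.
by rewrite scaleN1r [_ - _ in LHS]addrC addrACA.
Qed.

End CartesianDecomposition.

(** * The representation by functions on the set of positive characters *)

Section CharacterRepresentation.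
Variables (R : realType) (A : orderedStarAlgType R).
Hypothesis mulC : commutative (@GRing.mul A).
Local Notation H := (comm_herm mulC).

(** The points of the representing set. There are none for the zero algebra, where all
    [herm_const r] coincide. *)
Definition herm_character :=
  {phi : H -> R | positive_character (@herm_const _ _ _) (@herm_nneg _ _ _) phi}.

Section Character.
Variable phi : herm_character.
Implicit Types x y : herm A.

Lemma herm_characterD x y : sval phi (x + y) = sval phi x + sval phi y.
Proof. exact: (characterD (svalP phi)). Qed.

Lemma herm_characterZ (r : R) x : sval phi (r *: x) = r * sval phi x.
Proof.
rewrite -(@herm_constM _ _ mulC) (characterM (svalP phi)).
by rewrite (characterC (svalP phi)).
Qed.

Lemma herm_characterN x : sval phi (- x) = - sval phi x.
Proof. by rewrite -scaleN1r herm_characterZ mulN1r. Qed.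

Lemma herm_character0 : sval phi (0 : herm A) = 0.
Proof. by rewrite -(scale0r (0 : herm A)) herm_characterZ mul0r. Qed.

Lemma herm_character1 : sval phi (herm1 A) = 1.
Proof.
rewrite -[RHS](characterC (svalP phi)); congr (sval phi _).
by rewrite rmorph1.
Qed.

Lemma herm_characterM x y :
  sval phi (herm_mul (mulC (herm_val x) (herm_val y))) = sval phi x * sval phi y.
Proof. exact: (characterM (svalP phi)). Qed.

Lemma herm_character_ge0 x : 0 <= x -> 0 <= sval phi x.
Proof. exact: (character_ge0 (svalP phi)). Qed.

End Character.

(** The Gelfand transform: evaluation at each character, extended complex-linearly from Hermitian
    elements. *)
Definition character_rep (a : A) : herm_character -> R[i] :=
  fun phi => sval phi (herm_re a) +i* sval phi (herm_im a).

Lemma character_rep_cart (x y : herm A) :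
  character_rep (cart x y) = fun phi => sval phi x +i* sval phi y.
Proof.
by apply/funext => phi; rewrite /character_rep herm_re_cart herm_im_cart.
Qed.

Lemma herm_cart (x : herm A) : herm_val x = cart x 0.
Proof. by rewrite /cart /= scaler0 addr0. Qed.

Fact character_rep_linear : linear character_rep.
Proof.
move=> k a b; rewrite (cart_re_im a) (cart_re_im b).
rewrite cartZ cartD !character_rep_cart; apply/funext => phi.
rewrite !(herm_characterD, herm_characterN, herm_characterZ).
by case: k => p q.
Qed.

Fact character_rep_monoid_morphism : monoid_morphism character_rep.
Proof.
split.
  have -> : 1 = cart (herm1 A) 0 by rewrite -herm_cart.
  rewrite character_rep_cart; apply/funext => phi.
  by rewrite herm_character1 herm_character0.
move=> a b; rewrite (cart_re_im a) (cart_re_im b).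
rewrite (cartM mulC) !character_rep_cart; apply/funext => phi.
by rewrite !(herm_characterD, herm_characterN, herm_characterM).
Qed.

Fact character_rep_star : {morph character_rep : a / star a}.
Proof.
move=> a; rewrite (cart_re_im a) star_cart !character_rep_cart.
by apply/funext => phi; rewrite herm_characterN.
Qed.

Definition character_starHom : starHom A (herm_character -> R[i]) :=
  StarHom character_rep_linear character_rep_monoid_morphism character_rep_star.

End CharacterRepresentation.

(** * Faithful representations and closedness: both implications *)

Section StarHom.
Variables (R : realType) (A B : starAlgType R) (f : starHom A B).

Lemma starHom0 : f 0 = 0.
Proof.
have := starHom_linear f (-1) 0 0; rewrite scaler0 add0r => ->.
by rewrite scaleN1r addNr.
Qed.

Lemma starHom_scale k a : f (k *: a) = k *: f a.
Proof. by have := starHom_linear f k a 0; rewrite starHom0 !addr0. Qed.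

End StarHom.

(** Pointwise evaluation reduces the Archimedean property to that of the real numbers. *)
Lemma faithful_closed (R : realType) (A : orderedStarAlgType R) :
  has_faithful_representation A -> closed_star_alg A.
Proof.
move=> [X [pi [_ piP]]] v w w0 vw; rewrite -piP.
apply/asboolP => x.
have ule e : 0 < e -> pi (herm_val v) x <= e%:C * pi (herm_val w) x.
  move=> /vw; rewrite -piP => /asboolP/(_ x) /=.
  by rewrite starHom_scale.
have : pi (herm_val w) x >= 0.
  by move: w0; rewrite -piP => /asboolP/(_ x) /=; rewrite starHom0.
rewrite /= starHom0.
move: ule; case: (pi _ x) => p q; case: (pi _ x) => r s ule.
rewrite lecE /= => /andP[/eqP s0 r0]; rewrite {}s0 in ule.
(* Comparable complex numbers have equal imaginary parts, so the real value of [w] forces that of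
   [v] to be real too. *)
have {}ule e : 0 < e -> (q == 0) && (p <= e * r).
  by move=> /ule; simpc; rewrite eq_sym.
change (p +i* q <= 0 +i* 0); rewrite lecE /= eq_sym; have /andP[-> _] := ule _ ltr01.
apply/ler_addgt0Pr => e e0; rewrite add0r.
(* The bound is used at e / (r + 1), as r itself may vanish. *)
have r10 : 0 < r + 1 by rewrite ltr_wpDl.
have /andP[_ /le_trans->//] := ule _ (divr_gt0 e0 r10).
by rewrite mulrAC ler_pdivrMr// ler_pM2l// lerDl.
Qed.

(** If [a <= b] fails, [closed_separation] applied to b - a yields a point where the images violate
    the order. Injectivity then follows by antisymmetry. *)
Lemma closed_faithful (R : realType) (A : orderedStarAlgType R)
    (mulC : commutative (@GRing.mul A)) :
  sigma_bounded A -> radical_star_alg A -> closed_star_alg A ->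
  has_faithful_representation A.
Proof.
move=> sbA radA clA; exists (herm_character mulC), (character_starHom mulC).
have piE (x : herm A) phi :
    herm_val (herm_map (character_starHom mulC) x) phi = (sval phi x)%:C.
  by rewrite /= (herm_cart x) character_rep_cart herm_character0.
have mono : {mono herm_map (character_starHom mulC) : a b / a <= b}.
  move=> a b; apply/idP/idP => [/asboolP ab|ab].
    rewrite -herm_subr_ge0; apply: contrapT => /negP ba.
    have [phi phiP] := closed_separation mulC sbA radA clA ba.
    have := ab (exist _ phi phiP); rewrite !piE lecR -subr_ge0 -herm_characterN.
    by rewrite -herm_characterD /= leNgt => /negP.
  apply/asboolP => phi; rewrite !piE lecR -subr_ge0 -herm_characterN.
  by rewrite -herm_characterD herm_character_ge0// herm_subr_ge0.
split=> // a b e.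
by apply/le_anti; rewrite -!mono e !lexx.
Qed.

Theorem theorem4p29 (R : realType) (A : orderedStarAlgType R)
    (mulC : commutative (@GRing.mul A))
    (sbA : sigma_bounded A)
    (radA : radical_star_alg A) :
  has_faithful_representation A <-> closed_star_alg A.
Proof.
by split; [exact: faithful_closed|exact: closed_faithful].
Qed.
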